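(* Let $\{A_n\}_{n\ge 0}$ be the sequence of Apéry numbers, defined by $A_0=1$, $A_1=5$ and, for $n\ge 2$, $$n^3 A_n = (34n^3-51n^2+27n-5)A_{n-1} - (n-1)^3 A_{n-2}.$$ Then $\{A_n\}_{n\ge 0}$ is ratio log-concave, that is, for all integers $n\ge 2$, $$\left(\frac{A_n}{A_{n-1}}\right)^2 \ge \frac{A_{n-1}}{A_{n-2}}\cdot\frac{A_{n+1}}{A_n}.$$
   Context: A real sequence $\{S_n\}$ is called ratio log-concave if the sequence of ratios $\{S_n/S_{n-1}\}$ is log-concave. *)

(* Defs.v *)
From mathcomp Require Import all_boot all_order all_algebra.
From mathcomp Require Import reals.

Set Implicit Arguments.
Unset Strict Implicit.
Unset Printing Implicit Defensive.

Import Order.TTheory GRing.Theory Num.Theory.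
Local Open Scope ring_scope.

Definition log_concave (R : realType) (u : nat -> R) : Prop :=
  forall n : nat, (1 <= n)%N -> u n.-1 * u n.+1 <= u n ^+ 2.

(* Index shift: the ratio sequence (S_n / S_{n-1})_{n >= 1} is reindexed from 0. *)
Definition ratio_seq (R : realType) (S : nat -> R) : nat -> R :=
  fun n => S n.+1 / S n.

Definition ratio_log_concave (R : realType) (S : nat -> R) : Prop :=
  log_concave (ratio_seq S).

Lemma ratio_log_concaveP (R : realType) (S : nat -> R) :
  ratio_log_concave S <->
  forall n : nat, (2 <= n)%N ->
    (S n.-1 / S n.-2) * (S n.+1 / S n) <= (S n / S n.-1) ^+ 2.
Proof.
split=> H.
  by case=> [|[|n]] // _; exact: (H n.+1).
by case=> [|n] // _; exact: (H n.+2).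
Qed.

Definition is_apery (R : realType) (A : nat -> R) : Prop :=
  [/\ A 0%N = 1, A 1%N = 5 &
      forall n : nat, (2 <= n)%N ->
        n%:R ^+ 3 * A n =
          (34 * n%:R ^+ 3 - 51 * n%:R ^+ 2 + 27 * n%:R - 5) * A n.-1
          - (n%:R - 1) ^+ 3 * A n.-2].

(* Main.v *)
(** The ratios r_n = A_n / A_(n-1) satisfy
      n^3 r_n = P(n) - (n-1)^3 / r_(n-1),  P(n) = 34 n^3 - 51 n^2 + 27 n - 5.
    Eliminating r_(n-1) and r_(n+1) turns r_(n-1) r_(n+1) <= r_n^2 into
    g_n(r_n) >= 0 for an explicit quartic g_n that decreases near r_n, so an
    upper bound u_n >= r_n with g_n(u_n) >= 0 suffices. With
    lambda = 17 + 12 sqrt 2, the asymptotic expansion is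
      r_n = lambda (1 - 3/(2n) + (9/8 - 15 sqrt 2 / 64)/n^2 - c/n^3 + ...),
    c = 0.1473..., while g_n changes sign at the same expression with
    c = 0.1447...; we take u_n to be the cubic truncation with c = 7/48.
    As r |-> P(n) - (n-1)^3 / r is increasing, r_n <= u_n propagates by
    induction. After the shift n = m + 2, the polynomial inequalities have
    coefficients a + b sqrt 2 with b >= 0 and a + b >= 0. *)
Require Import Defs.
From mathcomp Require Import all_boot all_order all_algebra.
From mathcomp Require Import reals ring lra.

Set Implicit Arguments.
Unset Strict Implicit.
Unset Printing Implicit Defensive.
Import Order.TTheory GRing.Theory Num.Theory.
Local Open Scope ring_scope.

Section PolynomialBounds.
Variable R : realFieldType.
Implicit Types s x m : R.

Definition apery_coef x := 34 * x ^+ 3 - 51 * x ^+ 2 + 27 * x - 5.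
(* 192 lambda (x^3 - 3/2 x^2 + (9/8 - 15 s/64) x - 7/48) with lambda = 17 + 12 s
   and s^2 = 2 equals bound_rat x + bound_irr x * s. *)
Definition bound_rat x := 3264 * x ^+ 3 - 4896 * x ^+ 2 + 2592 * x - 476.
Definition bound_irr x := 2304 * x ^+ 3 - 3456 * x ^+ 2 + 1827 * x - 336.
Definition bound_num s x := bound_rat x + bound_irr x * s.

(** Writing [a + b * s] as [(a + b) + b * (s - 1)] shows that [1 <= s] is all the size information
    on sqrt 2 needed here. *)
Lemma add_mul_ge0 s (a b : R) :
  1 <= s -> 0 <= b -> 0 <= a + b -> 0 <= a + b * s.
Proof. by move=> ? ? ?; nra. Qed.

(** This is u(x+1) >= P(x+1) - x^3 / u(x) for u = N / (192 x^3), N = [bound_num s], multiplied by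
    192 N(x). *)
Lemma bound_step_poly s x :
  1 <= s -> s ^+ 2 = 2 -> 2 <= x ->
  0 <= bound_num s x * bound_num s (x + 1)
     - 192 * apery_coef (x + 1) * bound_num s x + 192 ^+ 2 * x ^+ 6.
Proof.
move=> s1 s2 x2; have [m -> m0] : exists2 m, x = m + 2 & 0 <= m.
  by exists (x - 2); lra.
rewrite /bound_num.
set e := bound_rat _; set f := bound_irr _.
set e' := bound_rat _; set f' := bound_irr _.
set p := apery_coef _.
(* Reduction modulo [s ^+ 2 = 2] leaves an expression linear in [s]; its two parts are polynomials
   in [m], and [lra] treats the powers of [m] as nonnegative atoms. *)
rewrite [leRHS](_ : _ =
    (e * (e' - 192 * p) + 2 * f * f' + 192 ^+ 2 * (m + 2) ^+ 6)
  + (e * f' + f * (e' - 192 * p)) * s); last by ring: s2.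
have m2 : 0 <= m ^+ 2 by exact: exprn_ge0.
have m3 : 0 <= m ^+ 3 by exact: exprn_ge0.
rewrite /e /e' /f /f' /p /bound_rat /bound_irr /apery_coef.
apply: add_mul_ge0 => //; lra.
Qed.

(** The left-out denominators are 192^4 x^9: this is the quartic g_x of the overview evaluated at
    u(x), times that factor. *)
Lemma bound_concave_poly s x :
  1 <= s -> s ^+ 2 = 2 -> 2 <= x ->
  0 <= bound_num s x ^+ 3 * (192 * apery_coef x - bound_num s x) * (x + 1) ^+ 3
     - 192 ^+ 3 * (x - 1) ^+ 3 * apery_coef (x + 1) * bound_num s x * x ^+ 6
     + 192 ^+ 4 * (x - 1) ^+ 3 * x ^+ 12.
Proof.
move=> s1 s2 x2; have [m -> m0] : exists2 m, x = m + 2 & 0 <= m.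
  by exists (x - 2); lra.
rewrite /bound_num.
set e := bound_rat _; set f := bound_irr _.
set p := apery_coef _; set p' := apery_coef _.
set z := m + 2.
rewrite [leRHS](_ : _ =
    (((e ^+ 3 + 6 * e * f ^+ 2) * (192 * p - e)
      - 2 * (3 * e ^+ 2 * f + 2 * f ^+ 3) * f) * (z + 1) ^+ 3
     - 192 ^+ 3 * (z - 1) ^+ 3 * p' * e * z ^+ 6
     + 192 ^+ 4 * (z - 1) ^+ 3 * z ^+ 12)
  + (((3 * e ^+ 2 * f + 2 * f ^+ 3) * (192 * p - e)
      - (e ^+ 3 + 6 * e * f ^+ 2) * f) * (z + 1) ^+ 3
     - 192 ^+ 3 * (z - 1) ^+ 3 * p' * f * z ^+ 6) * s); last by ring: s2.
have mk k : 0 <= m ^+ k by exact: exprn_ge0.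
have [[[m2 m3] m4] m5] := (mk 2, mk 3, mk 4, mk 5)%N.
have [[[m6 m7] m8] m9] := (mk 6, mk 7, mk 8, mk 9)%N.
have [[m10 m11] m12] := (mk 10, mk 11, mk 12)%N.
rewrite /e /f /p /p' /z /bound_rat /bound_irr /apery_coef.
apply: add_mul_ge0 => //; lra.
Qed.

Definition ratio_bound s x := bound_num s x / (192 * x ^+ 3).

Lemma bound_num_gt0 s x : 1 <= s -> 2 <= x -> 0 < bound_num s x.
Proof.
move=> s1 x2; have [m -> m0] : exists2 m, x = m + 2 & 0 <= m.
  by exists (x - 2); lra.
have m2 : 0 <= m ^+ 2 by exact: exprn_ge0.
have m3 : 0 <= m ^+ 3 by exact: exprn_ge0.
have f0 : 0 <= bound_irr (m + 2) by rewrite /bound_irr; lra.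
have e0 : 0 < bound_rat (m + 2) by rewrite /bound_rat; lra.
by rewrite ltr_pwDl // mulr_ge0 //; lra.
Qed.

Lemma ratio_bound_gt0 s x : 1 <= s -> 2 <= x -> 0 < ratio_bound s x.
Proof.
by move=> s1 x2; rewrite divr_gt0 ?bound_num_gt0 ?mulr_gt0 ?exprn_gt0 //; lra.
Qed.

Lemma ratio_bound_step s x r r' :
    1 <= s -> s ^+ 2 = 2 -> 2 <= x -> 0 < r ->
    (x + 1) ^+ 3 * r' = apery_coef (x + 1) - x ^+ 3 / r ->
  r <= ratio_bound s x -> r' <= ratio_bound s (x + 1).
Proof.
move=> s1 s2 x2 r0 Er ru; have x0 : 0 < x by lra.
have N0 := bound_num_gt0 s1 x2; have step := bound_step_poly s1 s2 x2.
have x1 : 0 < (x + 1) ^+ 3 by rewrite exprn_gt0 //; lra.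
have le_inv : x ^+ 3 / ratio_bound s x <= x ^+ 3 / r.
  by rewrite ler_wpM2l ?exprn_ge0 ?(ltW x0) // lef_pV2 ?posrE ?ratio_bound_gt0.
rewrite -(ler_pM2l x1) Er leNgt; apply/negP => lt_r.
have {le_inv} lt_u : (x + 1) ^+ 3 * ratio_bound s (x + 1)
    < apery_coef (x + 1) - x ^+ 3 / ratio_bound s x by lra.
have N192 : 0 < 192 * bound_num s x by lra.
(* Clearing denominators turns [lt_u] into the negation of [step]. *)
move: lt_u; rewrite -(ltr_pM2l N192) /ratio_bound.
have -> : 192 * bound_num s x * ((x + 1) ^+ 3
    * (bound_num s (x + 1) / (192 * (x + 1) ^+ 3)))
    = bound_num s x * bound_num s (x + 1).
  by field; rewrite gt_eqF //; lra.
have -> : 192 * bound_num s x * (apery_coef (x + 1)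
    - x ^+ 3 / (bound_num s x / (192 * x ^+ 3)))
    = 192 * bound_num s x * apery_coef (x + 1) - 192 ^+ 2 * x ^+ 6.
  by field; rewrite !gt_eqF //; lra.
by lra.
Qed.

(* For q, r, r' three consecutive ratios, r being that of index x, this is
   (r^2 - q r') (x+1)^3 r (P(x) - x^3 r). *)
Definition concave_gap x r :=
  r ^+ 3 * (apery_coef x - x ^+ 3 * r) * (x + 1) ^+ 3
  - (x - 1) ^+ 3 * apery_coef (x + 1) * r + (x - 1) ^+ 3 * x ^+ 3.

Lemma concave_gap_bound_ge0 s x :
  1 <= s -> s ^+ 2 = 2 -> 2 <= x -> 0 <= concave_gap x (ratio_bound s x).
Proof.
move=> s1 s2 x2; have x0 : 0 < x by lra.
have K0 : 0 < 192 ^+ 4 * x ^+ 9 by rewrite mulr_gt0 ?exprn_gt0.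
rewrite -(pmulr_rge0 _ K0) /concave_gap /ratio_bound.
move: (bound_concave_poly s1 s2 x2); congr (0 <= _).
by field; rewrite gt_eqF.
Qed.

(** With q >= 1 it gives x^3 r >= P(x) - (x-1)^3 >= 3/4 P(x), the range where [concave_gap]
    decreases. *)
Lemma apery_coef_ge x : 2 <= x -> 4 * (x - 1) ^+ 3 <= apery_coef x.
Proof.
move=> x2; have [m -> m0] : exists2 m, x = m + 2 & 0 <= m.
  by exists (x - 2); lra.
have m2 : 0 <= m ^+ 2 by exact: exprn_ge0.
have m3 : 0 <= m ^+ 3 by exact: exprn_ge0.
by rewrite /apery_coef; lra.
Qed.

(** The derivative of r^3 (P - x^3 r) is r^2 (3 P - 4 x^3 r), nonpositive under the third
    hypothesis; the proof uses the corresponding difference quotient. *)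
Lemma concave_gap_decr x r u :
    2 <= x -> 0 <= r -> 3 * apery_coef x <= 4 * (x ^+ 3 * r) -> r <= u ->
  concave_gap x u <= concave_gap x r.
Proof.
move=> x2 r0 rP ru; have x3 : 0 <= x ^+ 3 by rewrite exprn_ge0 //; lra.
have y3 : 0 <= (x + 1) ^+ 3 by rewrite exprn_ge0 //; lra.
have z3 : 0 <= (x - 1) ^+ 3 by rewrite exprn_ge0 //; lra.
have w3 : 0 <= (x + 1 - 1) ^+ 3 by rewrite exprn_ge0 //; lra.
have P0 := apery_coef_ge x2.
have P1 : 0 <= apery_coef (x + 1).
  have /apery_coef_ge : 2 <= x + 1 by lra.
  by lra.
have uP : 3 * apery_coef x <= 4 * (x ^+ 3 * u).
  by have := ler_wpM2l x3 ru; lra.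
rewrite -subr_ge0; rewrite [leRHS](_ : _ = (u - r) *
    ((x + 1) ^+ 3 * ((x ^+ 3 * r + x ^+ 3 * u) * (r ^+ 2 + u ^+ 2)
                     - apery_coef x * (r ^+ 2 + r * u + u ^+ 2))
     + (x - 1) ^+ 3 * apery_coef (x + 1))); last by rewrite /concave_gap; ring.
apply: mulr_ge0; first by rewrite subr_ge0.
apply: addr_ge0; apply: mulr_ge0 => //; rewrite subr_ge0.
have q0 : 0 <= r ^+ 2 + u ^+ 2 by rewrite addr_ge0 ?sqr_ge0.
have h1 : 3 / 2 * apery_coef x * (r ^+ 2 + u ^+ 2)
    <= (x ^+ 3 * r + x ^+ 3 * u) * (r ^+ 2 + u ^+ 2).
  by rewrite ler_wpM2r //; lra.
(* This gives P (r^2 + r u + u^2) <= 3/2 P (r^2 + u^2), to be chained with [h1]. *)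
have : 0 <= apery_coef x * (r - u) ^+ 2 by rewrite mulr_ge0 ?sqr_ge0 //; lra.
by lra.
Qed.

Lemma ratio_concave_step s x q r r' :
    1 <= s -> s ^+ 2 = 2 -> 2 <= x -> 1 <= q -> 0 < r ->
    x ^+ 3 * r = apery_coef x - (x - 1) ^+ 3 / q ->
    (x + 1) ^+ 3 * r' = apery_coef (x + 1) - x ^+ 3 / r ->
  r <= ratio_bound s x -> q * r' <= r ^+ 2.
Proof.
move=> s1 s2 x2 q1 r0 Er Er' ru; have q0 : 0 < q by lra.
have y3 : 0 < (x + 1) ^+ 3 by rewrite exprn_gt0 //; lra.
have z3 : 0 < (x - 1) ^+ 3 by rewrite exprn_gt0 //; lra.
have qV : (x - 1) ^+ 3 / q <= (x - 1) ^+ 3.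
  by rewrite ler_piMr ?invf_le1 // ltW.
have gap0 : 0 <= concave_gap x r.
  apply: le_trans (concave_gap_bound_ge0 s1 s2 x2) _.
  apply: concave_gap_decr => //; first exact: ltW.
  by have := apery_coef_ge x2; lra.
have D : q * (apery_coef x - x ^+ 3 * r) = (x - 1) ^+ 3.
  by rewrite Er; field; rewrite gt_eqF.
have K0 : 0 < (x + 1) ^+ 3 * r * (apery_coef x - x ^+ 3 * r).
  apply: mulr_gt0; first exact: mulr_gt0.
  by rewrite -(pmulr_rgt0 _ q0) D.
rewrite -(ler_pM2l K0) -subr_ge0; move: gap0; congr (0 <= _).
rewrite /concave_gap.
have -> : (x + 1) ^+ 3 * r * (apery_coef x - x ^+ 3 * r) * (q * r')
    = (q * (apery_coef x - x ^+ 3 * r)) * ((x + 1) ^+ 3 * r') * r by ring.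
by rewrite D Er'; field; rewrite gt_eqF.
Qed.
End PolynomialBounds.

Section Apery.
Variables (R : realType) (A : nat -> R).
Hypothesis hA : is_apery A.

Lemma apery_rec n : (n%:R + 2) ^+ 3 * A n.+2 =
  apery_coef (n%:R + 2) * A n.+1 - (n%:R + 1) ^+ 3 * A n.
Proof.
case: hA => _ _ /(_ n.+2 isT) /=; rewrite -addn2 natrD => ->.
by rewrite /apery_coef; ring.
Qed.

(** The subtracted term is absorbed by replacing [A n] with [A n.+1], since P(n+2) - (n+1)^3 >=
    (n+2)^3. *)
Lemma apery_gt0_incr n : 0 < A n /\ A n <= A n.+1.
Proof.
elim: n => [|n [A0 A1]]; first by case: hA => -> -> _; lra.
have m0 : 0 <= n%:R :> R by [].
split; first exact: lt_le_trans A1.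
have y3 : 0 < (n%:R + 2 : R) ^+ 3 by rewrite exprn_gt0 //; lra.
rewrite -(ler_pM2l y3) apery_rec.
have m2 : 0 <= n%:R ^+ 2 :> R by exact: exprn_ge0.
have m3 : 0 <= n%:R ^+ 3 :> R by exact: exprn_ge0.
have h1 : (n%:R + 1) ^+ 3 * A n <= (n%:R + 1) ^+ 3 * A n.+1.
  by rewrite ler_wpM2l // exprn_ge0 // addr_ge0.
have : 0 <= (apery_coef (n%:R + 2) - (n%:R + 1) ^+ 3 - (n%:R + 2) ^+ 3) * A n.+1.
  by rewrite mulr_ge0 //; [rewrite /apery_coef; lra | lra].
by lra.
Qed.

Lemma apery_neq0 n : A n != 0.
Proof. by rewrite gt_eqF //; case: (apery_gt0_incr n). Qed.

Lemma apery_ratio_ge1 n : 1 <= ratio_seq A n.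
Proof. by have [A0 ?] := apery_gt0_incr n; rewrite ler_pdivlMr // mul1r. Qed.

Lemma apery_ratio_rec n : (n%:R + 2) ^+ 3 * ratio_seq A n.+1 =
  apery_coef (n%:R + 2) - (n%:R + 1) ^+ 3 / ratio_seq A n.
Proof.
rewrite /ratio_seq mulrA apery_rec; field.
by rewrite !apery_neq0.
Qed.

Lemma apery_ratio_recS n : (n%:R + 2 + 1) ^+ 3 * ratio_seq A n.+2 =
  apery_coef (n%:R + 2 + 1) - (n%:R + 2) ^+ 3 / ratio_seq A n.+1.
Proof.
have -> : n%:R + 2 + 1 = n.+1%:R + 2 :> R by rewrite -natr1; ring.
by rewrite apery_ratio_rec; congr (_ - _ ^+ 3 / _); rewrite -natr1; ring.
Qed.

Lemma apery_ratio_le_bound n :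
  ratio_seq A n.+1 <= ratio_bound (Num.sqrt 2) (n%:R + 2).
Proof.
have s0 : 0 <= Num.sqrt 2 :> R by exact: sqrtr_ge0.
have s2 : Num.sqrt 2 ^+ 2 = 2 :> R by rewrite sqr_sqrtr.
(* Only the base case, 73/5 <= u(2), needs this precision: it amounts to sqrt 2 >= 1.41176
   approximately. *)
have s1 : 1412 / 1000 <= Num.sqrt 2 :> R by nra.
elim: n => [|n IHn].
  have := apery_ratio_rec 0; have -> : ratio_seq A 0 = 5.
    by rewrite /ratio_seq; case: hA => -> -> _; rewrite divr1.
  rewrite /ratio_bound /bound_num /bound_rat /bound_irr /apery_coef.
  by rewrite mulr0n !add0r ler_pdivlMr ?mulr_gt0 ?exprn_gt0 //; lra.
have -> : n.+1%:R + 2 = n%:R + 2 + 1 :> R by rewrite -natr1; ring.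
have m0 : 0 <= n%:R :> R by [].
apply: (ratio_bound_step _ s2 _ _ (apery_ratio_recS n) IHn); try lra.
exact: lt_le_trans (apery_ratio_ge1 _).
Qed.
End Apery.

Theorem theorem1p4 (R : realType) (A : nat -> R) (hA : is_apery A) :
  ratio_log_concave A.
Proof.
case=> [//|n] _ /=.
have s0 : 0 <= Num.sqrt 2 :> R by exact: sqrtr_ge0.
have s2 : Num.sqrt 2 ^+ 2 = 2 :> R by rewrite sqr_sqrtr.
have s1 : 1 <= Num.sqrt 2 :> R by nra.
(* [ratio_seq A n.+1] is r_(n+2), so the middle ratio has index x = n + 2. *)
have m0 : 2 <= n%:R + 2 :> R by rewrite lerDr.
apply: (ratio_concave_step s1 s2 m0 _ _ _ (apery_ratio_recS hA n)
  (apery_ratio_le_bound hA n)); first exact: apery_ratio_ge1.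
  exact: lt_le_trans (apery_ratio_ge1 hA _).
by rewrite apery_ratio_rec //; congr (_ - _ ^+ 3 / _); ring.
Qed.
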